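(* Let $n\ge 2$, $m\ge 1$ and let $Y_1,\dots,Y_n,X_1,\dots,X_m$ be $n+m$ indeterminates over $\mathbb{F}_q$. Write $\Delta:=\Delta_{n+m}(\underline Y,\underline X)$. Put $\delta_i:=(-1)^{i-1}\Delta_{n+m-1}(\underline{\hat Y_i},\underline X)$ for $1\le i\le n$ and $\delta_i:=(-1)^{i-1}\Delta_{n+m-1}(\underline Y,\underline{\hat X_{i-n}})$ for $n+1\le i\le n+m$. Let $A$ be the $(n+m)\times(n+m)$ matrix $$A:=\begin{pmatrix}\mathcal{M}_n(\delta_1,\dots,\delta_n)&\mathcal{M}_{n,m}(\delta_{n+1},\dots,\delta_{n+m})\\ 0&\mathrm{Id}_m\end{pmatrix},$$ with $0\in M_{m,n}(\mathbb{F}_q[\underline Y,\underline X])$, and for $k\ge1$ put $$\alpha_k:=\delta_1^{q^{k+1}}Y_1+\cdots+\delta_n^{q^{k+1}}Y_n+\delta_{n+1}^{q^{k+1}}X_1+\cdots+\delta_{n+m}^{q^{k+1}}X_m .$$ Then $A\;{}^t\mathcal{M}_{n+m}(\underline Y,\underline X)=M$, where $M=[m_{i,j}]_{1\le i,j\le n+m}=\begin{pmatrix} M_1 & M_2 \\ M_3 & M_4 \end{pmatrix}$ is given as follows. The first $n$ rows (blocks $M_1$ of size $n\times n$ and $M_2$ of size $n\times m$) satisfy: $m_{1,j}=0$ for $1\le j\le n+m-1$; $m_{1,n+m}=(-1)^{n+m-1}\Delta$; $m_{2,1}=\Delta$; $m_{2,j}=0$ for $2\le j\le n+m$; and for $3\le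 i\le n$: $m_{i,j}=\alpha_{i-j-1}^{q^{j-1}}$ for $1\le j\le i-2$, $m_{i,i-1}=\Delta^{q^{i-2}}$, and $m_{i,j}=0$ for $i\le j\le n+m$. That is, $$M_1=\begin{pmatrix} 0&\cdot&\cdot&\cdots&\cdot&0&0\\ \Delta&0&\cdot&\cdots&\cdot&0&0\\ \alpha_1&\Delta^q&0&\cdots&\cdot&0&0\\ \alpha_2&\alpha_1^q&\Delta^{q^2}&\cdots&\cdot&0&0\\ \vdots&\vdots&\vdots&\cdots&\cdot&\vdots&\vdots\\ \alpha_{n-2}&\alpha_{n-3}^q&\cdot&\cdots&\alpha_1^{q^{n-3}}&\Delta^{q^{n-2}}&0\end{pmatrix},$$ and $M_2$ has all entries $0$ except its upper right entry, which is $(-1)^{n+m-1}\Delta$. The last $m$ rows are given by $M_3={}^t\mathcal{M}_{n,m}(X_1,\dots,X_m)$ and $M_4={}^t\mathcal{M}_m(X_1^{q^n},\dots,X_m^{q^n})$.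
   Context: $q=p^s$ is a power of a prime $p$. For a commutative ring $R$ containing $\mathbb{F}_q$, integers $k,l\ge1$ and $\underline a=(a_1,\dots,a_l)\in R^l$, the Moore matrix of size $k,l$ is the $k\times l$ matrix $\mathcal{M}_{k,l}(\underline a):=\big(a_j^{q^{i-1}}\big)_{1\le i\le k,\,1\le j\le l}$ (row $i$, column $j$); $\mathcal{M}_l:=\mathcal{M}_{l,l}$, and $\Delta_l(\underline a):=\det\mathcal{M}_l(\underline a)$. $\underline Y=(Y_1,\dots,Y_n)$, $\underline X=(X_1,\dots,X_m)$; $\underline{\hat Y_i}$ (resp. $\underline{\hat X_i}$) is the tuple $\underline Y$ (resp. $\underline X$) with its $i$-th entry omitted; $(\underline Y,\underline X)$ etc. are concatenated tuples. ${}^tN$ is the transpose of $N$. *)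

(* Defs.v *)
From HB Require Import structures.
From mathcomp Require Import all_boot all_order all_algebra all_field.
From mathcomp Require Import mpoly.

Set Implicit Arguments.
Unset Strict Implicit.
Unset Printing Implicit Defensive.

Import GRing.Theory.
Local Open Scope ring_scope.

(* Throughout, F is the finite field with q = #|F| elements, and a commutative
   ring containing it is a commutative (nonzero) F-algebra.  Tuples of ring
   elements are row vectors. *)

(* Rows are numbered from 0, so the exponent q^(i-1) becomes q^i. *)
Definition Moore (F : finFieldType) (R : comAlgType F) (k l : nat)
    (a : 'rV[R]_l) : 'M[R]_(k, l) :=
  \matrix_(i < k, j < l) a 0 j ^+ (#|F| ^ i)%N.

Definition Moore_det (F : finFieldType) (R : comAlgType F) (l : nat)
    (a : 'rV[R]_l) : R :=
  \det (Moore l a).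

Section Construction.

Variables (F : finFieldType) (R : comAlgType F) (n m : nat).
Variables (Y : 'rV[R]_n) (X : 'rV[R]_m).

Local Notation q := #|F|.

Definition Delta : R := Moore_det (row_mx Y X).

(* deltaY is (delta_1, ..., delta_n); with i numbered from 0 its sign
   (-1)^(i-1) becomes (-1)^i.  [col' i Y] is Y with its i-th entry omitted. *)
Definition deltaY : 'rV[R]_n :=
  \row_(i < n) ((-1) ^+ i * Moore_det (row_mx (col' i Y) X)).

(* deltaX is (delta_(n+1), ..., delta_(n+m)). *)
Definition deltaX : 'rV[R]_m :=
  \row_(i < m) ((-1) ^+ (n + i)%N * Moore_det (row_mx Y (col' i X))).

Definition matA : 'M[R]_(n + m) :=
  block_mx (Moore n deltaY) (Moore n deltaX) 0 1%:M.

Definition alpha (k : nat) : R :=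
  \sum_(i < n) deltaY 0 i ^+ (q ^ k.+1)%N * Y 0 i
  + \sum_(i < m) deltaX 0 i ^+ (q ^ k.+1)%N * X 0 i.

(* The entry m_(i,j) of the first n rows, with i and j numbered from 1;
   only used for 1 <= i <= n and 1 <= j <= n + m. *)
Definition top_entry (i j : nat) : R :=
  if i == 1%N then
    if j == (n + m)%N then (-1) ^+ (n + m - 1)%N * Delta else 0
  else if i == 2%N then
    if j == 1%N then Delta else 0
  else if (j <= i - 2)%N then alpha (i - j - 1) ^+ (q ^ (j - 1))%N
  else if j == (i - 1)%N then Delta ^+ (q ^ (i - 2))%N
  else 0.

Definition matM : 'M[R]_(n + m) :=
  block_mx
    (\matrix_(i < n, j < n) top_entry i.+1 j.+1)
    (\matrix_(i < n, j < m) top_entry i.+1 (n + j.+1))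
    (Moore n X)^T
    (Moore m (\row_(j < m) X 0 j ^+ (q ^ n)%N))^T.

End Construction.

(* Main.v *)
Require Import Defs.
From HB Require Import structures.
From mathcomp Require Import all_boot all_order all_algebra all_field.
From mathcomp Require Import mpoly zify.

Set Implicit Arguments.
Unset Strict Implicit.
Unset Printing Implicit Defensive.

Import GRing.Theory.
Local Open Scope ring_scope.

(* Write Z = (Y, X) and N = n + m.  The entry (i, j) of the first n rows of the
   product is the pairing S(i, j) = sum_k delta_k^(q^i) Z_k^(q^j), with i and j
   numbered from 0.  The q-Frobenius is a ring morphism, so
   S(i + e, j + e) = S(i, j)^(q^e) and only the entries with i = 0 or j = 0
   matter.  The delta_k are, up to the global sign (-1)^(N-1), the cofactors of
   the last row of the Moore matrix of Z, so S(0, j) is (-1)^(N-1) Delta for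
   j = N - 1 and vanishes for j < N - 1.  The delta_k^q are the cofactors of its
   first row, so S(1, 0) = Delta.  Finally S(k + 1, 0) is alpha_k. *)

Section Frobenius.

Variables (F : finFieldType) (R : comAlgType F).

Lemma pchar_nat_card : [pchar R].-nat #|F|.
Proof.
have [p p_prime p_charF] := finPcharP F.
have p_charR : p \in [pchar R] by rewrite pchar_lalg.
by rewrite (eq_pnat _ (pcharf_eq p_charR)) (card_pprimeChar p_charF) pnatX
  pnat_id.
Qed.

Definition qfrob (k : nat) (x : R) : R := x ^+ (#|F| ^ k)%N.

Fact qfrob_is_nmod_morphism k : nmod_morphism (qfrob k).
Proof.
split=> [|x y]; last by rewrite /qfrob exprDn_pchar // pnatX pchar_nat_card.
by rewrite /qfrob expr0n expn_eq0 gtn_eqF // ltnW ?finNzRing_gt1.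
Qed.

Fact qfrob_is_monoid_morphism k : monoid_morphism (qfrob k).
Proof. by split=> [|x y]; rewrite /qfrob ?expr1n ?exprMn. Qed.

HB.instance Definition _ k :=
  GRing.isNmodMorphism.Build R R (qfrob k) (qfrob_is_nmod_morphism k).
HB.instance Definition _ k :=
  GRing.isMonoidMorphism.Build R R (qfrob k) (qfrob_is_monoid_morphism k).

Lemma qfrob0 x : qfrob 0 x = x.
Proof. by rewrite /qfrob expn0 expr1. Qed.

Lemma qfrobD i j x : qfrob (i + j) x = qfrob j (qfrob i x).
Proof. by rewrite /qfrob expnD exprM. Qed.

Definition qpairing N (a b : 'rV[R]_N) (i j : nat) : R :=
  \sum_(k < N) qfrob i (a 0 k) * qfrob j (b 0 k).

Lemma qpairingD N (a b : 'rV[R]_N) i j e :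
  qpairing a b (i + e) (j + e) = qfrob e (qpairing a b i j).
Proof.
by rewrite rmorph_sum; apply: eq_bigr => k _; rewrite rmorphM /= !qfrobD.
Qed.

Lemma qpairing_row_mx m n (a c : 'rV[R]_m) (b d : 'rV[R]_n) i j :
  qpairing (row_mx a b) (row_mx c d) i j = qpairing a c i j + qpairing b d i j.
Proof.
by rewrite /qpairing big_split_ord; congr (_ + _); apply: eq_bigr => k _;
  rewrite ?row_mxEl ?row_mxEr.
Qed.

End Frobenius.

Section MooreMatrix.

Variables (F : finFieldType) (R : comAlgType F).

Lemma Moore_mul_tr k l N (a b : 'rV[R]_N) :
  Moore k a *m (Moore l b)^T = \matrix_(i, j) qpairing a b i j.
Proof.
by apply/matrixP => i j; rewrite !mxE; apply: eq_bigr => h _; rewrite !mxE.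
Qed.

Lemma Moore_row_mx k m n (a : 'rV[R]_m) (b : 'rV[R]_n) :
  Moore k (row_mx a b) = row_mx (Moore k a) (Moore k b).
Proof.
by apply/matrixP => i j; rewrite !mxE; case: splitP => h _; rewrite mxE.
Qed.

Lemma Moore_addn k l N (a : 'rV[R]_N) :
  Moore (k + l) a = col_mx (Moore k a) (Moore l (map_mx (qfrob k) a)).
Proof.
apply/matrixP => i j; rewrite !mxE; case: splitP => h ->; rewrite !mxE //.
exact: qfrobD.
Qed.

Lemma Moore_det_castmx m n (eq_mn : m = n) (a : 'rV[R]_m) :
  Moore_det (castmx (erefl, eq_mn) a) = Moore_det a.
Proof. by case: n / eq_mn; rewrite castmx_id. Qed.

Definition Moore_delta N (Z : 'rV[R]_N) : 'rV[R]_N :=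
  \row_k ((-1) ^+ k * Moore_det (col' k Z)).

Lemma cofactor_Moore_first N (Z : 'rV[R]_N.+1) k :
  cofactor (Moore N.+1 Z) ord0 k = qfrob 1 (Moore_delta Z 0 k).
Proof.
rewrite mxE rmorphM rmorphXn rmorphN1 -det_map_mx; congr (_ * \det _).
by apply/matrixP => i j; rewrite !mxE -/(qfrob i _) /= -qfrobD addn1.
Qed.

Lemma cofactor_Moore_last N (Z : 'rV[R]_N.+1) k :
  cofactor (Moore N.+1 Z) ord_max k = (-1) ^+ N * Moore_delta Z 0 k.
Proof.
rewrite mxE mulrA -exprD; congr (_ * \det _).
by apply/matrixP => i j; rewrite !mxE lift_max.
Qed.

Variables (N : nat) (Z : 'rV[R]_N).

Lemma qpairing_Moore_delta0 j : (j < N)%N ->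
  qpairing (Moore_delta Z) Z 0 j =
    ((-1) ^+ N.-1 * Moore_det Z) *+ (j == N.-1).
Proof.
case: N Z => // N' Z' jN.
have /matrixP/(_ (Ordinal jN) ord_max) := mul_mx_adj (Moore N'.+1 Z').
rewrite !mxE -val_eqE /= -mulrnAr => <-.
rewrite mulr_sumr; apply: eq_bigr => k _.
by rewrite !mxE cofactor_Moore_last qfrob0 mulrCA signrMK mulrC !mxE.
Qed.

Lemma qpairing_Moore_delta_succ i : (0 < N)%N ->
  qpairing (Moore_delta Z) Z i.+1 i = qfrob i (Moore_det Z).
Proof.
case: N Z => // N' Z' _; rewrite -[i.+1]add1n -[X in qpairing _ _ _ X]add0n.
rewrite qpairingD /Moore_det (expand_det_row _ ord0); congr qfrob.
by apply: eq_bigr => k _; rewrite cofactor_Moore_first mulrC !mxE.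
Qed.

Lemma qpairing_Moore_delta_eq0 i j : (i <= j)%N -> (j - i < N.-1)%N ->
  qpairing (Moore_delta Z) Z i j = 0.
Proof.
move=> ij jiN; rewrite -[i]add0n -(subnK ij) qpairingD qpairing_Moore_delta0.
  by rewrite ltn_eqF ?rmorph0.
exact: leq_trans jiN (leq_pred N).
Qed.

End MooreMatrix.

Section Product.

Variables (F : finFieldType) (R : comAlgType F) (n m : nat).
Variables (Y : 'rV[R]_n) (X : 'rV[R]_m).

Local Notation Z := (row_mx Y X).

Lemma Moore_delta_row_mx : Moore_delta Z = row_mx (deltaY Y X) (deltaX Y X).
Proof.
apply/rowP => k; rewrite mxE; case: (split_ordP k) => h ->.
  rewrite row_mxEl mxE; congr (_ * _).
  by case: n Y h => [|n'] Y' h; [case: h | rewrite col'Kl].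
by rewrite row_mxEr mxE col'Kr Moore_det_castmx.
Qed.

Lemma alphaE k : alpha Y X k = qpairing (Moore_delta Z) Z k.+1 0.
Proof. by rewrite Moore_delta_row_mx qpairing_row_mx. Qed.

Lemma top_entryE i j : (1 < n + m)%N -> (j < n + m)%N ->
  top_entry Y X i.+1 j.+1 = qpairing (Moore_delta Z) Z i j.
Proof.
move=> nm_gt1 j_lt; rewrite /top_entry.
have nm_gt0 := ltnW nm_gt1; case: i => [|[|i]] /=.
- rewrite qpairing_Moore_delta0 // mulrb subn1.
  by congr (if _ then _ else _); lia.
- case: j j_lt => [|j] j_lt /=.
    by rewrite qpairing_Moore_delta_succ ?qfrob0.
  by rewrite qpairing_Moore_delta_eq0 //; lia.
rewrite !subSS !subn0 subn1 ltnS; case: leqP => [j_le_i|i_lt_j].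
  by rewrite alphaE -/(qfrob j _) -qpairingD; congr qpairing; lia.
case: eqP => [[->]|j_neq]; first by rewrite qpairing_Moore_delta_succ.
by rewrite qpairing_Moore_delta_eq0 //; lia.
Qed.

Lemma matA_col_mx :
  matA Y X = col_mx (Moore n (Moore_delta Z)) (row_mx 0 1%:M).
Proof. by rewrite Moore_delta_row_mx Moore_row_mx. Qed.

Lemma matM_col_mx : (1 < n + m)%N ->
  matM Y X = col_mx (\matrix_(i, j) qpairing (Moore_delta Z) Z i j)
                    (Moore (n + m) X)^T.
Proof.
move=> nm_gt1; rewrite Moore_addn tr_col_mx; congr col_mx; last first.
  by congr (row_mx _ (Moore _ _)^T); apply/rowP => j; rewrite !mxE.
apply/matrixP => i j; rewrite [RHS]mxE; case: (split_ordP j) => h -> /=.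
  by rewrite row_mxEl mxE top_entryE // ltn_addr.
by rewrite row_mxEr mxE addnS top_entryE // ltn_add2l.
Qed.

Lemma matA_mul_tr_Moore : (1 < n + m)%N ->
  matA Y X *m (Moore (n + m) Z)^T = matM Y X.
Proof.
move=> nm_gt1; rewrite matA_col_mx matM_col_mx // mul_col_mx Moore_mul_tr.
by rewrite Moore_row_mx tr_row_mx mul_row_col mul0mx mul1mx add0r.
Qed.

End Product.

Theorem theorem4p3 (F : finFieldType) (n m : nat)
    (hn : (2 <= n)%N) (hm : (1 <= m)%N) :
  let Y : 'rV[{mpoly F[n + m]}]_n := \row_(i < n) 'X_(lshift m i) in
  let X : 'rV[{mpoly F[n + m]}]_m := \row_(j < m) 'X_(rshift n j) in
  matA Y X *m (Moore (n + m) (row_mx Y X))^T = matM Y X.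
Proof. by move=> Y X; apply: matA_mul_tr_Moore; apply: ltn_addr. Qed.
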